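(* Let $(M,\omega)$ be a closed connected symplectic manifold admitting a symplectic quasi-state $\zeta$ which satisfies the PB-inequality with a constant $K>0$. (i) Let $X,Y,Z\subset M$ be closed superheavy (with respect to $\zeta$) sets with $X\cap Y\cap Z=\emptyset$. Then $pb_3(X,Y,Z)\ge \dfrac1K$. (ii) Let $X_0,X_1,Y_0,Y_1\subset M$ be closed subsets with $X_0\cap X_1=Y_0\cap Y_1=\emptyset$. If $X_0\cup Y_0$, $Y_0\cup X_1$, $X_1\cup Y_1$, $Y_1\cup X_0$ are all superheavy, then $$pb_4(X_0,X_1,Y_0,Y_1)\ge\frac1{4K}.$$ If $X_0\cup Y_0$, $Y_0\cup X_1$, $Y_1$ are all superheavy, then $$pb_4(X_0,X_1,Y_0,Y_1)\ge\frac1K.$$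
   Context: For smooth $F,G$ on $M$: $i_{\mathrm{sgrad}F}\,\omega=-dF$, $\{F,G\}=\omega(\mathrm{sgrad}\,G,\mathrm{sgrad}\,F)$, $\|F\|=\max_M|F|$. For continuous $F,G\in C(M)$ define $\|\{F,G\}\|=\liminf\|\{\overline F,\overline G\}\|$, the liminf being over smooth $\overline F,\overline G$ converging uniformly to $F,G$ (this agrees with the usual value for smooth functions). $F,G\in C(M)$ Poisson-commute if there are smooth $F_i\to F$, $G_i\to G$ uniformly with $\|\{F_i,G_i\}\|\to0$. A symplectic quasi-state is a functional $\zeta:C(M)\to\mathbb R$ such that $\zeta(1)=1$; $\zeta(F)\ge0$ if $F\ge0$; and $\zeta$ is linear on every Poisson-commutative linear subspace of $C(M)$ (one whose elements pairwise Poisson-commute). It satisfies the PB-inequality with constant $K>0$ if $|\zeta(F+G)-\zeta(F)-\zeta(G)|\le\sqrt{K\|\{F,G\}\|}$ for all $F,G\in C(M)$. A closed subset $X\subset M$ is superheavy with respect to $\zeta$ if for every $c\in\mathbb R$ and $F\in C(M)$ with $F|_X\ge c$ one has $\zeta(F)\ge c$ (and hence automatically $\zeta(F)\le c$ whenever $F|_X\le c$). $pb_3(X,Y,Z)=\inf\|\{F,G\}\|$ over smooth $F,G$ on $M$ with $F|_X\le0$, $G|_Y\le0$, $(F+G)|_Z\ge1$. $pb_4(X_0,X_1,Y_0,Y_1)=\inf\|\{F,G\}\|$ over smooth $F,G$ on $M$ with $F|_{X_0}\le0$, $F|_{X_1}\ge1$, $G|_{Y_0}\le0$, $G|_{Y_1}\ge1$.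 *)

(* Defs.v *)
From HB Require Import structures.
From mathcomp Require Import all_boot all_order all_algebra.
From mathcomp Require Import all_classical all_reals all_analysis.
Set Implicit Arguments.
Unset Strict Implicit.
Unset Printing Implicit Defensive.
Import Order.TTheory GRing.Theory Num.Theory.
Import numFieldNormedType.Exports.
Local Open Scope classical_set_scope.
Local Open Scope ring_scope.

Section Smooth.
Variables (R : realType) (n : nat).

Definition partial (i : 'I_n) (f : 'rV[R]_n -> R) : 'rV[R]_n -> R :=
  fun p => 'D_(delta_mx 0 i) f p.

(* For U open only: the values of f outside U are then irrelevant. *)
Fixpoint Ck (k : nat) (U : set 'rV[R]_n) (f : 'rV[R]_n -> R) : Prop :=
  if k is k'.+1 then
    (forall p, U p -> differentiable f p) /\ (forall i, Ck k' U (partial i f))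
  else forall p, U p -> {for p, continuous f}.

Definition smooth_on (U : set 'rV[R]_n) (f : 'rV[R]_n -> R) : Prop :=
  forall k, Ck k U f.

End Smooth.

(* A chart c is a homeomorphism from the open set chart_dom c onto the open set
   chart_img c; chart_fun c and chart_inv c have junk values elsewhere.  The
   charts form an atlas, not necessarily maximal. *)
Record smooth_manifold (R : realType) (n : nat) (M : topologicalType) :=
  SmoothManifold {
  chart : Type ;
  chart_dom : chart -> set M ;
  chart_fun : chart -> M -> 'rV[R]_n ;
  chart_inv : chart -> 'rV[R]_n -> M ;
  chart_img := fun c => chart_fun c @` chart_dom c ;
  transition := fun c d p => chart_fun d (chart_inv c p) ;
  chart_dom_open : forall c, open (chart_dom c) ;
  chart_img_open : forall c, open (chart_img c) ;
  chart_funK : forall c x, chart_dom c x -> chart_inv c (chart_fun c x) = x ;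
  chart_fun_continuous : forall c, {within chart_dom c, continuous (chart_fun c)} ;
  chart_inv_continuous : forall c, {within chart_img c, continuous (chart_inv c)} ;
  chart_at : M -> chart ;
  chart_at_dom : forall x, chart_dom (chart_at x) x ;
  transition_smooth : forall c d j,
    smooth_on (chart_fun c @` (chart_dom c `&` chart_dom d))
              (fun p => transition c d p 0 j) ;
  manifold_hausdorff : hausdorff_space M ;
  manifold_second_countable : @second_countable M
}.

(* In the chart c, tangent vectors are the rows v : 'rV_n and the form is
   omega(v, w) = v *m form c p *m w^T.  The rows transform by right
   multiplication by the Jacobian matrix of the transition map. *)
Record symplectic_form (R : realType) (n : nat) (M : topologicalType)
    (A : smooth_manifold R n M) := SymplecticForm {
  form : chart A -> 'rV[R]_n -> 'M[R]_n ;
  form_smooth : forall c i j, smooth_on (chart_img c) (fun p => form c p i j) ;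
  form_alternating : forall c p, chart_img c p -> (form c p)^T = - form c p ;
  form_transition : forall (c d : chart A) x, chart_dom c x -> chart_dom d x ->
    let J := 'J (transition c d) (chart_fun c x) in
    form c (chart_fun c x) = J *m form d (chart_fun d x) *m J^T ;
  form_closed : forall c p i j k, chart_img c p ->
    partial i (fun q => form c q j k) p + partial j (fun q => form c q k i) p
      + partial k (fun q => form c q i j) p = 0 ;
  form_nondegenerate : forall c p, chart_img c p -> form c p \in unitmx
}.

Section PoissonBracket.
Variables (R : realType) (n : nat) (M : topologicalType).
Variables (A : smooth_manifold R n M) (w : symplectic_form A).

Definition smooth (F : M -> R) : Prop :=
  forall c : chart A, smooth_on (chart_img c) (F \o chart_inv c).

Definition dfun (F : M -> R) (c : chart A) (x : M) : 'rV[R]_n :=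
  \row_i partial i (F \o chart_inv c) (chart_fun c x).

Definition form_at (c : chart A) (x : M) (u v : 'rV[R]_n) : R :=
  (u *m form w c (chart_fun c x) *m v^T) 0 0.

Definition sgrad (F : M -> R) (c : chart A) (x : M) : 'rV[R]_n :=
  - dfun F c x *m invmx (form w c (chart_fun c x)).

Lemma sgradP (F : M -> R) (c : chart A) (x : M) (u : 'rV[R]_n) :
  chart_dom c x ->
  u = sgrad F c x <->
  forall v : 'rV[R]_n, form_at c x u v = - (dfun F c x *m v^T) 0 0.
Proof.
move=> cx; have U : form w c (chart_fun c x) \in unitmx.
  by apply: form_nondegenerate; exists x.
split=> [-> v|H]; first by rewrite /form_at /sgrad mulmxKV // mulNmx mxE.
suff E : u *m form w c (chart_fun c x) = - dfun F c x by rewrite /sgrad -E mulmxK.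
apply/rowP => j; move: (H (delta_mx 0 j)); rewrite /form_at trmx_delta.
by rewrite -!colE !mxE.
Qed.

(* The value at x does not depend on the chart, by form_transition. *)
Definition poisson (F G : M -> R) (x : M) : R :=
  let c := chart_at A x in form_at c x (sgrad G c x) (sgrad F c x).

(* Valued in \bar R, so that an unbounded H has no junk norm. *)
Definition supnorm (H : M -> R) : \bar R :=
  ereal_sup (range (fun x => `|H x|%:E)).

Definition poisson_norm (F G : M -> R) : \bar R :=
  limf_einf (fun P : {uniform M -> R} * {uniform M -> R} =>
               supnorm (poisson P.1 P.2))
    (within [set P | smooth P.1 /\ smooth P.2]
       (nbhs ((F, G) : {uniform M -> R} * {uniform M -> R}))).

Definition poisson_commute (F G : M -> R) : Prop :=
  exists F_ G_ : nat -> M -> R,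
    [/\ forall i, smooth (F_ i) /\ smooth (G_ i),
        {uniform, F_ @ \oo --> F}, {uniform, G_ @ \oo --> G} &
        supnorm (poisson (F_ i) (G_ i)) @[i --> \oo] --> 0%E].

Definition poisson_commutative_subspace (L : set (M -> R)) : Prop :=
  [/\ forall F, L F -> continuous F,
      L 0, forall (a : R) F G, L F -> L G -> L (a *: F + G) &
      forall F G, L F -> L G -> poisson_commute F G].

(* Functionals on C(M) are represented by functionals on M -> R of which only
   the values at continuous functions are ever used. *)
Record symplectic_quasi_state (zeta : (M -> R) -> R) : Prop := {
  quasi_state1 : zeta (cst 1) = 1 ;
  quasi_state_ge0 : forall F : M -> R, continuous F -> (forall x, 0 <= F x) -> 0 <= zeta F ;
  quasi_state_linear : forall L, poisson_commutative_subspace L ->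
    forall (a : R) (F G : M -> R), L F -> L G -> zeta (a *: F + G) = a * zeta F + zeta G
}.

Definition pb_inequality (zeta : (M -> R) -> R) (K : R) : Prop :=
  forall F G : M -> R, continuous F -> continuous G ->
    (`|zeta (F + G) - zeta F - zeta G|%:E <= sqrte (K%:E * poisson_norm F G))%E.

Definition superheavy (zeta : (M -> R) -> R) (X : set M) : Prop :=
  closed X /\
  forall (c : R) (F : M -> R), continuous F -> (forall x, X x -> c <= F x) -> c <= zeta F.

Definition pb3 (X Y Z : set M) : \bar R :=
  ereal_inf [set supnorm (poisson P.1 P.2) | P in
    [set P : (M -> R) * (M -> R) |
      [/\ smooth P.1 /\ smooth P.2,
          forall x, X x -> P.1 x <= 0,
          forall x, Y x -> P.2 x <= 0 &
          forall x, Z x -> 1 <= P.1 x + P.2 x]]].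

Definition pb4 (X0 X1 Y0 Y1 : set M) : \bar R :=
  ereal_inf [set supnorm (poisson P.1 P.2) | P in
    [set P : (M -> R) * (M -> R) |
      smooth P.1 /\ smooth P.2 /\
      [/\ forall x, X0 x -> P.1 x <= 0,
          forall x, X1 x -> 1 <= P.1 x,
          forall x, Y0 x -> P.2 x <= 0 &
          forall x, Y1 x -> 1 <= P.2 x]]].

End PoissonBracket.

(* Main.v *)
(** Write [F] and [G] for the competitors in [pb3] or [pb4].  For (i),
    superheaviness gives [zeta F <= 0], [zeta G <= 0] and [zeta (F + G) >= 1],
    and the PB-inequality concludes.

    For (ii), compose [F] and [G] with a smooth step [R -> [0, 1]] of slope at
    most [1]; this does not increase the bracket and costs an error [d] in the
    boundary conditions.  The resulting [f, g] satisfy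
    [{f g, (1 - f) g} = g {f, g}], and [zeta (f g)], [zeta ((1 - f) g)] are at most
    [d] since these products are small on superheavy sets.  The PB-inequality then
    bounds [zeta g], the value on the sum, by about [sqrt (K ||{F, G}||)].  In one
    case [zeta g] is close to [1]; in the other the same bound for [1 - g] gives
    [1 <= 2 sqrt (K ||{F, G}||)] in the limit [d -> 0].

    [zeta] is only ever evaluated on smooth functions: the linear span of [1] and a
    smooth [F] is Poisson-commutative by constant approximating sequences, and at a
    smooth pair the liminf defining [poisson_norm] is at most the supremum norm of
    the bracket. *)
Require Import Defs.
From HB Require Import structures.
From mathcomp Require Import all_boot all_order all_algebra.
From mathcomp Require Import all_classical all_reals all_analysis.
From mathcomp Require Import ring lra.
Set Implicit Arguments.
Unset Strict Implicit.
Unset Printing Implicit Defensive.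
Import Order.TTheory GRing.Theory Num.Theory.
Import numFieldNormedType.Exports.
Local Open Scope classical_set_scope.
Local Open Scope ring_scope.

(** * Calculus of $C^k$ functions on an open subset of a coordinate space *)

Lemma near_eq_differentiable (R : numFieldType) (V W : normedModType R)
    (f g : V -> W) (x : V) :
  {near x, f =1 g} -> differentiable f x -> differentiable g x.
Proof.
move=> fg /diff_locallyP[dc df].
have fgx : f x = g x by exact: nbhs_singleton fg.
(* Since [f] and [g] agree near [x] and at [x], the first-order expansion of [f] is one of [g];
   uniqueness of the differential then identifies ['d g x]. *)
have dg : g \o shift x = cst (g x) + 'd f x +o_ 0 id.
  move/eqaddoP : df => df; apply/eqaddoP => e e0.
  have fg0 : \forall h \near 0, f (h + x) = g (h + x).
    have := near_shift 0 x [set y | f y = g y].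
    by rewrite subr0 /= => <-.
  near=> h; have fgh : f (h + x) = g (h + x) by near: h.
  by rewrite !fctE /= -fgh -fgx; near: h; exact: df.
have dfg : 'd g x = 'd f x :> (V -> W) by exact: diff_unique.
by apply/diff_locallyP; rewrite dfg.
Unshelve. all: by end_near. Qed.

Section Ck_closure.
Variables (R : realType) (n : nat) (U : set 'rV[R]_n).
Hypothesis openU : open U.
Implicit Types (f g : 'rV[R]_n -> R) (k : nat) (i : 'I_n).

Lemma CkSW k f : Ck k.+1 U f -> Ck k U f.
Proof.
elim: k f => [|k IHk] f [df pf].
  by move=> p Up; apply: differentiable_continuous; exact: df.
by split=> // i; apply: IHk.
Qed.

Lemma eq_partial f g i :
  {in U, f =1 g} -> {in U, partial i f =1 partial i g}.
Proof.
by move=> fg p Up; exact: near_eq_derive (open_in_nearW openU fg Up).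
Qed.

(** As [U] is open, equality on [U] is equality near each of its points and so passes to partial
    derivatives. The closure lemmas need this because the sum, product and chain rules are only
    available at points of [U]. *)
Lemma eq_Ck k f g : {in U, f =1 g} -> Ck k U f -> Ck k U g.
Proof.
elim: k f g => [|k IHk] f g fg /=.
  move=> cf p /mem_set Up; have := cf p (set_mem Up).
  rewrite /prop_for /continuous_at -(fg p Up) => /(cvg_trans _); apply.
  exact: near_eq_cvg (open_in_nearW openU fg Up : {near p, f =1 g}).
move=> [df pf]; split=> [p /mem_set Up|i].
  apply: near_eq_differentiable (df p (set_mem Up)).
  exact: (open_in_nearW openU fg Up).
by apply: IHk (pf i); exact: eq_partial.
Qed.

Lemma Ck_cst k (a : R) : Ck k U (cst a).
Proof.
elim: k a => [|k IHk] a /=; first by move=> p _; exact: cst_continuous.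
split=> [p _|i]; first exact: differentiable_cst.
apply: eq_Ck (IHk 0) => p _; rewrite /partial /=.
by rewrite derive_cst.
Qed.

Lemma partialD f g i p : differentiable f p -> differentiable g p ->
  partial i (f + g) p = partial i f p + partial i g p.
Proof. by move=> df dg; rewrite /partial deriveD//; exact: diff_derivable. Qed.

Lemma partialM f g i p : differentiable f p -> differentiable g p ->
  partial i (f * g) p = f p * partial i g p + g p * partial i f p.
Proof. by move=> df dg; rewrite /partial deriveM//; exact: diff_derivable. Qed.

Lemma partial_comp (phi : R -> R) (a : R) f i p :
  differentiable f p -> is_derive (f p) 1 phi a ->
  partial i (phi \o f) p = a * partial i f p.
Proof.
move=> df dphi; have dphi' : differentiable phi (f p).
  by apply/derivable1_diffP; exact: ex_derive.
rewrite /partial deriveE; last exact: differentiable_comp.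
rewrite diff_comp//= diff1E// derive1E derive_val deriveE//.
by rewrite mulrC.
Qed.

Lemma CkD k f g : Ck k U f -> Ck k U g -> Ck k U (f + g).
Proof.
elim: k f g => [|k IHk] f g /=.
  by move=> cf cg p Up; exact: continuousD (cf p Up) (cg p Up).
move=> [df pf] [dg pg]; split=> [p Up|i].
  by apply: differentiableD; [exact: df|exact: dg].
apply: eq_Ck (IHk _ _ (pf i) (pg i)) => p; rewrite inE => Up.
by rewrite partialD//; [exact: df|exact: dg].
Qed.

Lemma CkM k f g : Ck k U f -> Ck k U g -> Ck k U (f * g).
Proof.
elim: k f g => [|k IHk] f g.
  by move=> cf cg p Up; exact: continuousM (cf p Up) (cg p Up).
move=> Cf Cg; have [df pf] := Cf; have [dg pg] := Cg; split=> [p Up|i].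
  by apply: differentiableM; [exact: df|exact: dg].
have := CkD (IHk _ _ (CkSW Cf) (pg i)) (IHk _ _ (CkSW Cg) (pf i)).
apply: eq_Ck => p; rewrite inE => Up.
by rewrite partialM//; [exact: df|exact: dg].
Qed.

(* The equation [r' = - t r^3] expresses the partial derivatives of [r \o f] through
   [f], [r \o f] and those of [f], which closes the induction on [k]. *)
Lemma Ck_comp_ode k (r : R -> R) f :
  (forall t : R, is_derive t 1 r (- t * r t ^+ 3)) ->
  Ck k U f -> Ck k U (r \o f).
Proof.
move=> dr; have rd t : differentiable r t.
  by apply/derivable1_diffP; exact: ex_derive.
elim: k f => [|k IHk] f.
  move=> cf p Up; apply: continuous_comp; first exact: cf.
  exact: differentiable_continuous.
move=> Cf; have [df pf] := Cf; split=> [p Up|i].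
  by apply: differentiable_comp => //; exact: df.
have Cr := IHk _ (CkSW Cf).
have := CkM (CkM (CkM (Ck_cst k (-1)) (CkSW Cf)) (CkM Cr (CkM Cr Cr))) (pf i).
apply: eq_Ck => p; rewrite inE => Up; rewrite (partial_comp _ _ (dr _))/=; last exact: df.
by rewrite !fctE /=; ring.
Qed.

End Ck_closure.

(** * An explicit smooth step function of slope at most one *)

Section SmoothStep.
Variables (R : realType) (d : R).
Hypothesis d_gt0 : 0 < d.
Implicit Types t : R.

Definition smooth_abs t : R := Num.sqrt (t ^+ 2 + d ^+ 2).

(** With [smooth_abs] replaced by the absolute value, this is the truncation of $t$ to $[0,1]$. *)
Definition smooth_step t : R := (smooth_abs t - smooth_abs (t - 1) + 1) / 2.

Definition smooth_step' t : R :=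
  (t / smooth_abs t - (t - 1) / smooth_abs (t - 1)) / 2.

Lemma smooth_abs_gt0 t : 0 < smooth_abs t.
Proof. by rewrite sqrtr_gt0 ltr_wpDl ?sqr_ge0 ?exprn_gt0. Qed.

Lemma sqr_smooth_abs t : smooth_abs t ^+ 2 = t ^+ 2 + d ^+ 2.
Proof. by rewrite sqr_sqrtr// addr_ge0 ?sqr_ge0. Qed.

Lemma ler_norm_smooth_abs t : `|t| <= smooth_abs t.
Proof.
rewrite -sqrtr_sqr ler_sqrt ?lerDl ?sqr_ge0//.
by rewrite ltW// ltr_wpDl ?sqr_ge0 ?exprn_gt0.
Qed.

Lemma smooth_abs_le t : smooth_abs t <= `|t| + d.
Proof.
have s0 := ltW (smooth_abs_gt0 t); have a0 : 0 <= `|t| + d by rewrite addr_ge0// ltW.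
rewrite -ler_sqr ?nnegrE//.
rewrite sqr_smooth_abs sqrrD real_normK ?num_real// lerD2r lerDl.
by rewrite mulrn_wge0// mulr_ge0// ltW.
Qed.

(** Squaring and cancelling $d^2$ and $(s-t)^2$ leaves $t(s-t)$ against [smooth_abs t * |s - t|].
    The case $|s-t|=1$ keeps the step within $[0,1]$. *)
Lemma smooth_abs_contraction s t :
  smooth_abs s <= smooth_abs t + `|s - t|.
Proof.
have s0 := ltW (smooth_abs_gt0 s); have t0 := ltW (smooth_abs_gt0 t).
rewrite -ler_sqr ?nnegrE ?addr_ge0//.
rewrite sqrrD !sqr_smooth_abs real_normK ?num_real//.
have : t * (s - t) <= smooth_abs t * `|s - t|.
  rewrite (le_trans (ler_norm _))// normrM ler_wpM2r//.
  exact: ler_norm_smooth_abs.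
lra.
Qed.

Lemma smooth_step_itv t : 0 <= smooth_step t <= 1.
Proof.
have := smooth_abs_contraction t (t - 1).
have := smooth_abs_contraction (t - 1) t.
rewrite [`|t - 1 - t|]distrC subKr normr1 /smooth_step.
lra.
Qed.

Lemma smooth_step_le t : t <= 0 -> smooth_step t <= d.
Proof.
move=> t0; have := ler_norm_smooth_abs (t - 1); have := smooth_abs_le t.
have t10 : t - 1 <= 0 by lra.
rewrite !ler0_norm// /smooth_step; have := d_gt0; lra.
Qed.

(** Evenness of [smooth_abs] makes the step symmetric about $1/2$. This yields the estimate for $t
    \ge 1$ from the one for $t \le 0$, and later lets $1-G$ stand in for $G$. *)
Lemma smooth_step_1B t : smooth_step (1 - t) = 1 - smooth_step t.
Proof.
rewrite /smooth_step /smooth_abs (_ : 1 - t - 1 = - t); last by ring.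
by rewrite sqrrN -[1 - t]opprB sqrrN; field.
Qed.

Lemma smooth_step_ge t : 1 <= t -> 1 - d <= smooth_step t.
Proof.
move=> t1; have : 1 - t <= 0 by rewrite subr_le0.
by move/smooth_step_le; rewrite smooth_step_1B; lra.
Qed.

Lemma normr_smooth_step' t : `|smooth_step' t| <= 1.
Proof.
have H s : `|s / smooth_abs s| <= 1.
  rewrite normrM normfV (gtr0_norm (smooth_abs_gt0 s)).
  by rewrite ler_pdivrMr ?mul1r ?smooth_abs_gt0 ?ler_norm_smooth_abs.
have := H t; have := H (t - 1); rewrite /smooth_step' !ler_norml.
lra.
Qed.

Lemma is_derive_smooth_abs t : is_derive t 1 smooth_abs (t / smooth_abs t).
Proof.
have d2 : is_derive t 1 (fun s : R => s ^+ 2 + d ^+ 2) (2 * t).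
  by apply: is_derive_eq; rewrite addr0 /GRing.scale/=; ring.
have t0 : 0 < t ^+ 2 + d ^+ 2 by rewrite -sqr_smooth_abs exprn_gt0 ?smooth_abs_gt0.
have := @is_derive1_comp _ Num.sqrt _ t _ _ (is_derive1_sqrt t0) d2.
rewrite [X in is_derive _ _ _ X](_ : _ = t / smooth_abs t)// /smooth_abs.
by field; rewrite gt_eqF// -/(smooth_abs t) smooth_abs_gt0.
Qed.

(** The reciprocal of [smooth_abs] satisfies an equation polynomial in $t$ and itself, the one
    required by [Ck_comp_ode]. *)
Lemma is_derive_smooth_absV t : is_derive t 1 (fun s => (smooth_abs s)^-1)
  (- t * (smooth_abs t)^-1 ^+ 3).
Proof.
have s0 : smooth_abs t != 0 by rewrite gt_eqF ?smooth_abs_gt0.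
have := is_deriveV s0 (is_derive_smooth_abs t).
rewrite [X in is_derive _ _ _ X -> _](_ : _ = - t * (smooth_abs t)^-1 ^+ 3)//.
by rewrite /GRing.scale/=; field.
Qed.

Lemma is_derive_smooth_step t : is_derive t 1 smooth_step (smooth_step' t).
Proof.
have ds : is_derive t 1 (fun s : R => smooth_abs (s - 1))
    ((t - 1) / smooth_abs (t - 1)).
  have dt : is_derive t 1 (fun s : R => s - 1) 1.
    by apply: is_derive_eq; rewrite subr0.
  have := @is_derive1_comp _ smooth_abs _ t _ _ (is_derive_smooth_abs (t - 1)) dt.
  by rewrite mulr1.
have da := is_derive_smooth_abs t.
have e : smooth_step = (2^-1 : R) \*: (smooth_abs - (fun s => smooth_abs (s - 1)) + cst 1).
  by apply/funext => s; rewrite /smooth_step mulrC.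
rewrite e; apply: is_derive_eq.
by rewrite addr0 /smooth_step' /GRing.scale/= mulrC.
Qed.

End SmoothStep.

(** * Smooth functions on the manifold and their differentials *)

Section SmoothFunctions.
Variables (R : realType) (n : nat) (M : topologicalType).
Variables (A : smooth_manifold R n M).
Implicit Types (F G : M -> R) (c : chart A) (x : M).

Lemma smooth_cst (a : R) : smooth A (cst a).
Proof. by move=> c k; apply: Ck_cst; exact: chart_img_open. Qed.

Lemma smoothD F G : smooth A F -> smooth A G -> smooth A (F + G).
Proof.
move=> sF sG c k; have oc := chart_img_open (c := c).
exact: CkD oc _ _ _ (sF c k) (sG c k).
Qed.

Lemma smoothM F G : smooth A F -> smooth A G -> smooth A (F * G).
Proof.
move=> sF sG c k; have oc := chart_img_open (c := c).
exact: CkM oc _ _ _ (sF c k) (sG c k).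
Qed.

Lemma smoothZ (a : R) F : smooth A F -> smooth A (a *: F).
Proof.
by move=> sF; have := smoothM (smooth_cst a) sF.
Qed.

Lemma smoothN F : smooth A F -> smooth A (- F).
Proof. by move=> sF; rewrite -scaleN1r; exact: smoothZ. Qed.

Lemma smoothB F G : smooth A F -> smooth A G -> smooth A (F - G).
Proof. by move=> sF sG; apply: smoothD => //; exact: smoothN. Qed.

Lemma smooth_smooth_abs (d : R) F :
  0 < d -> smooth A F -> smooth A (smooth_abs d \o F).
Proof.
move=> d0 sF.
have sV : smooth A ((fun s => (smooth_abs d s)^-1) \o F).
  move=> c k; have oc := chart_img_open (c := c).
  exact: Ck_comp_ode oc _ _ _ (is_derive_smooth_absV d0) (sF c k).
(* From $s = s^2 \cdot s^{-1}$, where $s^2 = F^2 + d^2$ is polynomial in $F$ and $s^{-1}$ is the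
   reciprocal already shown smooth. *)
rewrite (_ : _ \o _ =
    (F * F + cst (d ^+ 2)) * ((fun s => (smooth_abs d s)^-1) \o F)).
  by apply: smoothM sV; apply: smoothD; [exact: smoothM|exact: smooth_cst].
apply/funext => x; rewrite !fctE /= -expr2 -sqr_smooth_abs expr2 mulfK//.
by rewrite gt_eqF ?smooth_abs_gt0.
Qed.

Lemma smooth_smooth_step (d : R) F :
  0 < d -> smooth A F -> smooth A (smooth_step d \o F).
Proof.
move=> d0 sF.
rewrite (_ : _ \o _ = (2^-1 : R) *: ((smooth_abs d \o F)
    - (smooth_abs d \o (F - cst 1)) + cst 1)); last first.
  by apply/funext => x; rewrite /smooth_step/= mulrC.
apply/smoothZ/smoothD; last exact: smooth_cst.
apply: smoothB; first exact: smooth_smooth_abs.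
by apply: smooth_smooth_abs => //; apply: smoothB => //; exact: smooth_cst.
Qed.

Lemma smooth_continuous F : smooth A F -> continuous F.
Proof.
move=> sF x; set c := chart_at A x.
have cx : chart_dom c x by exact: chart_at_dom.
have oc := @chart_dom_open _ _ _ A c.
have cc : {for x, continuous (chart_fun c)}.
  have := @chart_fun_continuous _ _ _ A c.
  by rewrite continuous_open_subspace// => /(_ x); apply; rewrite inE.
have cF : {for chart_fun c x, continuous (F \o chart_inv c)}.
  by have := sF c 0; apply; exists x.
have cK : {in chart_dom c, F \o chart_inv c \o chart_fun c =1 F}.
  by move=> y /set_mem cy /=; rewrite chart_funK.
have : (F \o chart_inv c \o chart_fun c) y @[y --> x] -->
    (F \o chart_inv c \o chart_fun c) x by exact: continuous_comp cc cF.
rewrite (cK _ (mem_set cx)); apply: cvg_trans.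
exact: near_eq_cvg (open_in_nearW oc cK (mem_set cx) : {near x, _ =1 F}).
Qed.

Lemma smooth_differentiable F c x : smooth A F -> chart_dom c x ->
  differentiable (F \o chart_inv c) (chart_fun c x).
Proof. by move=> sF cx; have [dF _] := sF c 1; apply: dF; exists x. Qed.

Lemma dfun_cst (a : R) c x : dfun (cst a) c x = 0.
Proof. by apply/rowP => i; rewrite !mxE /partial derive_cst. Qed.

Lemma dfunD F G c x : smooth A F -> smooth A G -> chart_dom c x ->
  dfun (F + G) c x = dfun F c x + dfun G c x.
Proof.
move=> sF sG cx; apply/rowP => i; rewrite !mxE.
by rewrite -partialD//; exact: smooth_differentiable.
Qed.

Lemma dfunM F G c x : smooth A F -> smooth A G -> chart_dom c x ->
  dfun (F * G) c x = G x *: dfun F c x + F x *: dfun G c x.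
Proof.
move=> sF sG cx; apply/rowP => i; rewrite !mxE addrC.
have := @partialM _ _ _ _ i _ (smooth_differentiable sF cx) (smooth_differentiable sG cx).
by rewrite /= chart_funK.
Qed.

Lemma dfunZ (a : R) F c x : smooth A F -> chart_dom c x ->
  dfun (a *: F) c x = a *: dfun F c x.
Proof.
move=> sF cx; have := dfunM (smooth_cst a) sF cx.
by rewrite dfun_cst scaler0 add0r.
Qed.

Lemma dfun_smooth_step (d : R) F c x : 0 < d -> smooth A F -> chart_dom c x ->
  dfun (smooth_step d \o F) c x = smooth_step' d (F x) *: dfun F c x.
Proof.
move=> d0 sF cx; apply/rowP => i; rewrite !mxE.
have := partial_comp i (smooth_differentiable sF cx) (is_derive_smooth_step d0 _).
by rewrite /= chart_funK.
Qed.

End SmoothFunctions.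

(** * The Poisson bracket and its norms *)

Section Poisson.
Variables (R : realType) (n : nat) (M : topologicalType).
Variables (A : smooth_manifold R n M) (w : symplectic_form A).
Implicit Types (F G f g u v : M -> R) (x : M).

(** The Poisson bivector at [x]: the inverse of the symplectic form, acting on covectors in the
    chosen chart. *)
Definition copairing x (a b : 'rV[R]_n) : R :=
  let c := chart_at A x in (a *m invmx (Defs.form w c (chart_fun c x)) *m b^T) 0 0.

Lemma chart_at_img x : chart_img (chart_at A x) (chart_fun (chart_at A x) x).
Proof. by exists x => //; exact: chart_at_dom. Qed.

Lemma trmx_invmx_form x : let W := Defs.form w (chart_at A x) (chart_fun (chart_at A x) x) in
  (invmx W)^T = - invmx W.
Proof.
move=> W; have U : W \in unitmx by exact: form_nondegenerate (chart_at_img x).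
rewrite trmx_inv form_alternating; last exact: chart_at_img.
by rewrite -/W -scaleN1r invmxZ ?unitmxZ ?unitrN1// invrN invr1 scaleN1r.
Qed.

Lemma copairingC x a b : copairing x a b = - copairing x b a.
Proof.
rewrite /copairing; set W := Defs.form _ _ _.
have -> : a *m invmx W *m b^T = - (b *m invmx W *m a^T)^T.
  by rewrite !trmx_mul trmxK trmx_invmx_form mulNmx mulmxN mulmxA opprK.
by rewrite !mxE.
Qed.

Lemma copairing_lin x (s t : R) a a' b :
  copairing x (s *: a + t *: a') b = s * copairing x a b + t * copairing x a' b.
Proof. by rewrite /copairing !mulmxDl -!scalemxAl !mxE. Qed.

Lemma poissonE F G x :
  poisson w F G x = copairing x (dfun F (chart_at A x) x) (dfun G (chart_at A x) x).
Proof.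
rewrite copairingC /poisson /form_at /sgrad mulmxKV; last first.
  exact: form_nondegenerate (chart_at_img x).
rewrite !mulNmx linearN/= mulmxN opprK trmx_mul trmx_invmx_form.
by rewrite mulNmx mulmxN mulmxA mxE.
Qed.

(** The bracket is an alternating bilinear form in the differentials, so a linear substitution
    multiplies it by the determinant. All bracket computations below reduce to this. *)
Lemma poisson_det F G u v x (a b a' b' : R) :
  let c := chart_at A x in
  dfun u c x = a *: dfun F c x + b *: dfun G c x ->
  dfun v c x = a' *: dfun F c x + b' *: dfun G c x ->
  poisson w u v x = (a * b' - b * a') * poisson w F G x.
Proof.
move=> c du dv; rewrite !poissonE -/c du dv copairing_lin.
rewrite 2!(copairingC _ _ (_ + _)) !copairing_lin.
have alt y : copairing x y y = 0.
  by have := copairingC x y y; lra.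
rewrite !alt (copairingC _ (dfun G c x) (dfun F c x)); ring.
Qed.

(** The substitution is diagonal, with the two slopes of the step as entries, and each slope is at
    most one in absolute value. *)
Lemma poisson_smooth_step_le (d N : R) F G : 0 < d -> smooth A F -> smooth A G ->
  (forall x, `|poisson w F G x| <= N) ->
  forall x, `|poisson w (smooth_step d \o F) (smooth_step d \o G) x| <= N.
Proof.
move=> d0 sF sG FGN x; have cx := chart_at_dom A x.
have dF : dfun (smooth_step d \o F) (chart_at A x) x =
    smooth_step' d (F x) *: dfun F (chart_at A x) x + 0 *: dfun G (chart_at A x) x.
  by rewrite dfun_smooth_step// scale0r addr0.
have dG : dfun (smooth_step d \o G) (chart_at A x) x =
    0 *: dfun F (chart_at A x) x + smooth_step' d (G x) *: dfun G (chart_at A x) x.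
  by rewrite dfun_smooth_step// scale0r add0r.
rewrite (poisson_det dF dG) mul0r subr0 normrM.
apply: le_trans (FGN x); rewrite ler_piMl//.
by rewrite (normrM (smooth_step' d (F x))) mulr_ile1// normr_smooth_step'.
Qed.

Lemma poisson_1B F G x : smooth A F -> smooth A G ->
  poisson w F (cst 1 - G) x = - poisson w F G x.
Proof.
move=> sF sG; have cx := chart_at_dom A x.
have dF : dfun F (chart_at A x) x =
    1 *: dfun F (chart_at A x) x + 0 *: dfun G (chart_at A x) x.
  by rewrite scale1r scale0r addr0.
have dG : dfun (cst 1 - G) (chart_at A x) x =
    0 *: dfun F (chart_at A x) x + (-1) *: dfun G (chart_at A x) x.
  rewrite (dfunD (smooth_cst 1) (smoothN sG) cx) dfun_cst -scaleN1r dfunZ//.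
  by rewrite scale0r.
by rewrite (poisson_det dF dG); ring.
Qed.

Lemma supnorm_leP (H : M -> R) (N : R) :
  reflect (forall x, `|H x| <= N) (supnorm H <= N%:E)%E.
Proof.
apply: (iffP idP) => [HN x|HN].
  by rewrite -lee_fin (le_trans _ HN)//; apply: ereal_sup_ubound; exists x.
by apply: ge_ereal_sup => _ [x _ <-]; rewrite lee_fin.
Qed.

(** A point of [M] makes the supremum nonnegative, which excludes [-oo]; at [+oo] the bound is
    trivial, so real upper bounds suffice. *)
Lemma supnorm_ge (H : M -> R) (N : R) : [set: M] !=set0 ->
  (forall N' : R, 0 <= N' -> (forall x, `|H x| <= N') -> N <= N') ->
  (N%:E <= supnorm H)%E.
Proof.
move=> [x0 _] HN.
have H0 : (0 <= supnorm H)%E.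
  apply: (@le_trans _ _ `|H x0|%:E); first by rewrite lee_fin.
  by apply: ereal_sup_ubound; exists x0.
case E : (supnorm H) H0 => [N'| |]// N'0; last by rewrite leey.
by rewrite lee_fin HN//; apply/supnorm_leP; rewrite E.
Qed.

(** A smooth pair belongs to every set of the filter defining the liminf, so each infimum over such
    a set is at most the value at the pair. *)
Lemma poisson_norm_le_supnorm F G : smooth A F -> smooth A G ->
  (poisson_norm w F G <= supnorm (poisson w F G))%E.
Proof.
move=> sF sG; rewrite /poisson_norm limf_einfE.
apply: ge_ereal_sup => _ [V FV <-]; apply: ereal_inf_lbound.
exists (F, G) => //; exact: (nbhs_singleton FV).
Qed.

Lemma poisson_commute_smooth F G : [set: M] !=set0 ->
  smooth A F -> smooth A G -> (forall x, poisson w F G x = 0) ->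
  poisson_commute w F G.
Proof.
move=> [x0 _] sF sG FG0; exists (fun=> F), (fun=> G); split=> //.
- exact: (@cvg_cst {uniform M -> R}).
- exact: (@cvg_cst {uniform M -> R}).
rewrite (_ : supnorm _ = 0%E); first exact: cvg_cst.
apply/eqP; rewrite eq_le; apply/andP; split.
  by apply/supnorm_leP => x; rewrite FG0 normr0.
by apply: supnorm_ge => [|N N0 _//]; exists x0.
Qed.

End Poisson.

(** * Quasi-states on smooth functions and superheavy sets *)

Section QuasiState.
Variables (R : realType) (n : nat) (M : topologicalType).
Variables (A : smooth_manifold R n M) (w : symplectic_form A).
Hypothesis M_nonempty : [set: M] !=set0.
Variable zeta : (M -> R) -> R.
Hypothesis zeta_qs : symplectic_quasi_state w zeta.
Implicit Types (F G u v : M -> R) (X Y : set M).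

(** The differential of every element is a multiple of $dF$, so all brackets vanish. *)
Lemma affine_poisson_commutative F : smooth A F ->
  poisson_commutative_subspace w [set a *: F + cst b | a in setT & b in setT].
Proof.
move=> sF; have saff (a b : R) : smooth A (a *: F + cst b).
  by apply: smoothD; [exact: smoothZ|exact: smooth_cst].
have daff (a b : R) (c : chart A) x : chart_dom c x ->
    dfun (a *: F + cst b) c x = a *: dfun F c x + 0 *: dfun F c x.
  move=> cx; rewrite (dfunD (smoothZ a sF) (smooth_cst b) cx).
  by rewrite dfunZ// dfun_cst scale0r.
split.
- by move=> _ [a _ [b _ <-]]; exact: smooth_continuous (saff a b).
- by exists 0 => //; exists 0 => //; apply/funext => x; rewrite !fctE scale0r addr0.
- move=> s _ _ [a _ [b _ <-]] [a' _ [b' _ <-]].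
  exists (s * a + a') => //; exists (s * b + b') => //.
  by apply/funext => x; rewrite !fctE /GRing.scale/=; ring.
- move=> _ _ [a _ [b _ <-]] [a' _ [b' _ <-]].
  apply: poisson_commute_smooth => // x.
  have cx := chart_at_dom A x.
  by rewrite (poisson_det w (daff a b _ _ cx) (daff a' b' _ _ cx)); ring.
Qed.

Lemma quasi_state_affine (a b : R) F : smooth A F ->
  zeta (a *: F + cst b) = a * zeta F + b.
Proof.
move=> sF; have := quasi_state_linear zeta_qs (affine_poisson_commutative sF).
set L := [set _ | _ in _ & _ in _] => lin.
have LF : L F.
  by exists 1 => //; exists 0 => //; apply/funext => x; rewrite !fctE/= scale1r addr0.
have Lcst t : L (cst t).
  by exists 0 => //; exists t => //; apply/funext => x; rewrite !fctE/= scale0r add0r.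
(* Additivity on $0 + 0$ gives $\zeta(0) = 2\zeta(0)$. *)
have zeta0 : zeta (cst 0) = 0.
  have := lin 1 _ _ (Lcst 0) (Lcst 0); rewrite scale1r addr0 mul1r.
  by move/eqP; rewrite -subr_eq subrr eq_sym => /eqP.
rewrite lin//; congr (_ + _).
have := lin b _ _ (Lcst 1) (Lcst 0).
rewrite (quasi_state1 zeta_qs) zeta0 mulr1 [b + 0]addr0 => {2}<-.
by congr zeta; apply/funext => x; rewrite !fctE/= addr0 /GRing.scale/= mulr1.
Qed.

Lemma superheavy_ge X F (c : R) : superheavy zeta X -> smooth A F ->
  (forall x, X x -> c <= F x) -> c <= zeta F.
Proof. by move=> [_ hX] sF; apply: hX; exact: smooth_continuous sF. Qed.

(** Superheaviness is applied to $-F$, written as an affine function of $F$ so that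
    [quasi_state_affine] gives $\zeta(-F) = -\zeta(F)$. *)
Lemma superheavy_le X F (c : R) : superheavy zeta X -> smooth A F ->
  (forall x, X x -> F x <= c) -> zeta F <= c.
Proof.
move=> hX sF FX; have sF' : smooth A (-1 *: F + cst 0).
  by apply: smoothD; [exact: smoothZ|exact: smooth_cst].
rewrite -lerN2; have -> : - zeta F = zeta (-1 *: F + cst 0).
  by rewrite quasi_state_affine// addr0 mulN1r.
apply: (superheavy_ge hX sF') => x Xx.
by rewrite !fctE/= addr0 scaleN1r lerN2 FX.
Qed.

Variable K : R.
Hypothesis K_gt0 : 0 < K.
Hypothesis zeta_pb : pb_inequality w zeta K.

Lemma pb_smooth F G (N : R) : smooth A F -> smooth A G -> 0 <= N ->
  (forall x, `|poisson w F G x| <= N) ->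
  `|zeta (F + G) - zeta F - zeta G| <= Num.sqrt (K * N).
Proof.
move=> sF sG N0 FGN; rewrite -lee_fin.
apply: le_trans (zeta_pb (smooth_continuous sF) (smooth_continuous sG)) _.
rewrite -[leRHS]/(sqrte (K * N)%:E) lee_sqrt; last first.
  by rewrite lee_fin mulr_ge0// ltW.
rewrite EFinM lee_pmul2l//.
apply: le_trans (poisson_norm_le_supnorm w sF sG) _.
exact/supnorm_leP.
Qed.

(** Split $v = uv + (1-u)v$. On [X] a factor of the first product is at most $d$, on [Y] a factor of
    the second, while the other factor lies in $[0,1]$; the PB-inequality controls the defect of
    additivity. *)
Lemma quasi_state_le_of_partition X Y u v (d N : R) :
  superheavy zeta X -> superheavy zeta Y -> smooth A u -> smooth A v ->
  (forall x, 0 <= u x <= 1) -> (forall x, 0 <= v x <= 1) ->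
  (forall x, X x -> u x <= d \/ v x <= d) ->
  (forall x, Y x -> 1 - u x <= d \/ v x <= d) ->
  0 <= N -> (forall x, `|poisson w u v x| <= N) ->
  zeta v <= 2 * d + Num.sqrt (K * N).
Proof.
move=> hX hY su sv u01 v01 uvX uvY N0 uvN.
have s1u : smooth A (cst 1 - u) by apply: smoothB => //; exact: smooth_cst.
have suv := smoothM su sv; have s1uv := smoothM s1u sv.
have le1 : zeta (u * v) <= d.
  apply: (superheavy_le hX suv) => x /uvX; rewrite fctE.
  by have := u01 x; have := v01 x; nra.
have le2 : zeta ((cst 1 - u) * v) <= d.
  apply: (superheavy_le hY s1uv) => x /uvY; rewrite !fctE/=.
  by have := u01 x; have := v01 x; nra.
(* The coefficient rows are $(v, u)$ and $(-v, 1-u)$, with determinant $v(1-u) + uv = v$. *)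
have bracket x : poisson w (u * v) ((cst 1 - u) * v) x = v x * poisson w u v x.
  have cx := chart_at_dom A x.
  have duv := dfunM su sv cx.
  have d1u : dfun (cst 1 - u) (chart_at A x) x = - dfun u (chart_at A x) x.
    rewrite (dfunD (smooth_cst 1) (smoothN su) cx).
    by rewrite dfun_cst add0r -scaleN1r dfunZ// scaleN1r.
  have d1uv : dfun ((cst 1 - u) * v) (chart_at A x) x =
      (- v x) *: dfun u (chart_at A x) x + (1 - u x) *: dfun v (chart_at A x) x.
    by rewrite dfunM// d1u scalerN scaleNr.
  by rewrite (poisson_det w duv d1uv); ring.
have uvN' x : `|poisson w (u * v) ((cst 1 - u) * v) x| <= N.
  rewrite bracket normrM; have := v01 x; have := uvN x.
  by move=> ? /andP[v0 v1]; rewrite ger0_norm//; nra.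
have := pb_smooth suv s1uv N0 uvN'.
have -> : u * v + (cst 1 - u) * v = v.
  by apply/funext => x; rewrite !fctE/=; ring.
by rewrite ler_norml; lra.
Qed.

Lemma quasi_state_smooth_step_le X0 X1 Y F G (d N : R) :
  superheavy zeta (X0 `|` Y) -> superheavy zeta (X1 `|` Y) ->
  smooth A F -> smooth A G ->
  (forall x, X0 x -> F x <= 0) -> (forall x, X1 x -> 1 <= F x) ->
  (forall x, Y x -> G x <= 0) -> 0 < d ->
  0 <= N -> (forall x, `|poisson w F G x| <= N) ->
  zeta (smooth_step d \o G) <= 2 * d + Num.sqrt (K * N).
Proof.
move=> h0 h1 sF sG FX0 FX1 GY d0 N0 FGN.
apply: (quasi_state_le_of_partition h0 h1 (smooth_smooth_step d0 sF)) => //.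
- exact: smooth_smooth_step.
- by move=> x; exact: smooth_step_itv.
- by move=> x; exact: smooth_step_itv.
- by move=> x [/FX0|/GY] H; [left|right]; exact: smooth_step_le.
- move=> x [/FX1|/GY] H; [left|by right; exact: smooth_step_le].
  by have := smooth_step_ge d0 H; rewrite /=; lra.
- exact: poisson_smooth_step_le.
Qed.

End QuasiState.

(** * The lower bounds for [pb3] and [pb4] *)

Lemma ler_addZ_gt0P (R : realType) (x y C : R) : 0 < C ->
  (forall d, 0 < d -> x <= y + C * d) -> x <= y.
Proof.
move=> C0 H; apply/ler_addgt0Pr => e e0.
by have := H (e / C) (divr_gt0 e0 C0); rewrite mulrC divfK ?gt_eqF.
Qed.

Theorem theorem1p15 (R : realType) (n : nat) (M : topologicalType)
    (A : smooth_manifold R n M) (w : symplectic_form A)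
    (M_nonempty : [set: M] !=set0)
    (M_compact : compact [set: M]) (M_connected : connected [set: M])
    (zeta : (M -> R) -> R) (zeta_qs : symplectic_quasi_state w zeta)
    (K : R) (K_gt0 : 0 < K) (zeta_pb : pb_inequality w zeta K) :
  (forall X Y Z : set M,
     superheavy zeta X -> superheavy zeta Y -> superheavy zeta Z ->
     X `&` Y `&` Z = set0 ->
     ((K^-1)%:E <= pb3 w X Y Z)%E) /\
  (forall X0 X1 Y0 Y1 : set M,
     closed X0 -> closed X1 -> closed Y0 -> closed Y1 ->
     X0 `&` X1 = set0 -> Y0 `&` Y1 = set0 ->
     (superheavy zeta (X0 `|` Y0) -> superheavy zeta (Y0 `|` X1) ->
      superheavy zeta (X1 `|` Y1) -> superheavy zeta (Y1 `|` X0) ->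
      (((4 * K)^-1)%:E <= pb4 w X0 X1 Y0 Y1)%E) /\
     (superheavy zeta (X0 `|` Y0) -> superheavy zeta (Y0 `|` X1) ->
      superheavy zeta Y1 ->
      ((K^-1)%:E <= pb4 w X0 X1 Y0 Y1)%E)).
Proof.
have KN_ge0 N : 0 <= N -> 0 <= K * N := mulr_ge0 (ltW K_gt0).
split=> [X Y Z hX hY hZ _|X0 X1 Y0 Y1 _ _ _ _ _ _].
  apply: le_ereal_inf_tmp => _ [[F G] /= [[sF sG] FX GY FGZ] <-].
  apply: supnorm_ge => // N N0 FGN.
  have zF := superheavy_le M_nonempty zeta_qs hX sF FX.
  have zG := superheavy_le M_nonempty zeta_qs hY sG GY.
  have zFG : 1 <= zeta (F + G) by exact: superheavy_ge hZ (smoothD sF sG) FGZ.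
  have := pb_smooth K_gt0 zeta_pb sF sG N0 FGN.
  rewrite ler_norml => /andP[_ zFGN].
  rewrite -[K^-1]mul1r ler_pdivrMr// mulrC -(sqr_sqrtr (KN_ge0 N N0)) expr_ge1//.
  lra.
have step_le := quasi_state_smooth_step_le M_nonempty zeta_qs K_gt0 zeta_pb.
split=> [h00|h00]; rewrite [Y0 `|` X1]setUC => h10;
  [rewrite [Y1 `|` X0]setUC => h11 h01|move=> h1];
  apply: le_ereal_inf_tmp => _ [[F G] /= [sF [sG [FX0 FX1 GY0 GY1]]] <-];
  apply: supnorm_ge => // N N0 FGN.
- suff : 2^-1 <= Num.sqrt (K * N).
    move=> H; rewrite -[X in X <= _]mul1r ler_pdivrMr ?mulr_gt0//.
    by rewrite mulrC -mulrA -(sqr_sqrtr (KN_ge0 N N0)); nra.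
  (* With $g$ the step of $G$, both $\zeta(g)$ and $1-\zeta(g)$ will be at most $2d + \sqrt{KN}$;
     adding and halving leaves the error $2d$. *)
  apply: (@ler_addZ_gt0P _ _ _ 2) => // d d0.
  have zg := step_le _ _ _ F G d N h00 h10 sF sG FX0 FX1 GY0 d0 N0 FGN.
  (* Passing to $1-G$ puts [Y1] in the role of [Y0] and only changes the sign of the bracket. *)
  have s1G : smooth A (cst 1 - G) by apply: smoothB => //; exact: smooth_cst.
  have F1GN x : `|poisson w F (cst 1 - G) x| <= N by rewrite poisson_1B// normrN.
  have GY1' x : Y1 x -> (cst 1 - G) x <= 0.
    by move=> /GY1; rewrite !fctE/= subr_le0.
  have := step_le _ _ _ F _ d N h01 h11 sF s1G FX0 FX1 GY1' d0 N0 F1GN.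
  rewrite (_ : _ \o _ = (-1) *: (smooth_step d \o G) + cst 1); last first.
    apply/funext => x; rewrite -[RHS]/(-1 *: smooth_step d (G x) + 1) scaleN1r.
    by rewrite [RHS]addrC -smooth_step_1B.
  rewrite (quasi_state_affine M_nonempty zeta_qs); last exact: smooth_smooth_step.
  by lra.
- suff : 1 <= Num.sqrt (K * N).
    move=> H; rewrite -[K^-1]mul1r ler_pdivrMr// mulrC.
    by rewrite -(sqr_sqrtr (KN_ge0 N N0)) expr_ge1.
  (* The error $3d$ combines $2d$ from the upper bound on $\zeta(g)$ with $d$ from the lower bound
     $1-d$ that superheaviness of [Y1] provides. *)
  apply: (@ler_addZ_gt0P _ _ _ 3) => // d d0.
  have zg := step_le _ _ _ F G d N h00 h10 sF sG FX0 FX1 GY0 d0 N0 FGN.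
  have : 1 - d <= zeta (smooth_step d \o G).
    apply: (superheavy_ge h1 (smooth_smooth_step d0 sG)) => x /GY1.
    exact: smooth_step_ge.
  by lra.
Qed.
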